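(* Let $\Omega$ be a nonempty open set in $\mathbb{R}^n$. If $s_1,s_2\in\mathbb{R}$ and $1<p_1,p_2<\infty$ are such that $W^{s_1,p_1}(\Omega)\hookrightarrow W^{s_2,p_2}(\Omega)$, then $W^{s_1,p_1}_{loc}(\Omega)\hookrightarrow W^{s_2,p_2}_{loc}(\Omega)$.
   Context: All functions are real-valued. $C_c^\infty(\Omega)$ is the set of smooth functions with compact support in $\Omega$; $D'(\Omega)$ is the space of distributions on $\Omega$. Let $1<p<\infty$ and $\frac1p+\frac1{p'}=1$. Sobolev-Slobodeckij spaces: for $k\in\mathbb{N}_0$, $W^{k,p}(\Omega)=\{u\in L^p(\Omega):\|u\|_{W^{k,p}(\Omega)}:=\sum_{|\nu|\le k}\|\partial^\nu u\|_{L^p(\Omega)}<\infty\}$; for $0<\theta<1$, $|u|_{W^{\theta,p}(\Omega)}:=\big(\iint_{\Omega\times\Omega}\frac{|u(x)-u(y)|^p}{|x-y|^{n+\theta p}}dx\,dy\big)^{1/p}$; for $s=k+\theta$ with $k\in\mathbb{N}_0$, $0<\theta<1$, $W^{s,p}(\Omega)=\{u\in W^{k,p}(\Omega):\|u\|_{W^{s,p}(\Omega)}:=\|u\|_{W^{k,p}(\Omega)}+\sum_{|\nu|=k}|\partial^\nu u|_{W^{\theta,p}(\Omega)}<\infty\}$. $W^{s,p}_0(\Omega)$ is the closure of $C_c^\infty(\Omega)$ in $W^{s,p}(\Omega)$. For $s<0$, $W^{s,p}(\Omega)=(W^{-s,p'}_0(\Omega))^*$ with the dual norm, viewed as a subspace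 of $D'(\Omega)$ by restricting functionals to $C_c^\infty(\Omega)$. For $s\in\mathbb{R}$, $W^{s,p}_{loc}(\Omega)=\{u\in D'(\Omega):\varphi u\in W^{s,p}(\Omega)\ \forall\varphi\in C_c^\infty(\Omega)\}$, equipped with the topology induced by the family of seminorms $|u|_{\varphi,s,p}:=\|\varphi u\|_{W^{s,p}(\Omega)}$, $\varphi\in C_c^\infty(\Omega)$. For topological spaces, $X\hookrightarrow Y$ means $X\subseteq Y$ and the inclusion map is continuous (here everything is regarded as a subspace of $D'(\Omega)$). *)

(* Defs.v *)
From HB Require Import structures.
From mathcomp Require Import all_boot all_order all_algebra.
From mathcomp Require Import all_classical all_reals all_analysis.

Set Implicit Arguments.
Unset Strict Implicit.
Unset Printing Implicit Defensive.

Import Order.TTheory GRing.Theory Num.Theory.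
Import numFieldNormedType.Exports.

Local Open Scope classical_set_scope.
Local Open Scope ring_scope.

Definition rV_display : measure_display. Proof. exact. Qed.

Section rV_measurable.
Context (R : realType) (n : nat).

Let coord (i : 'I_n) (x : 'rV[R]_n) : measurableTypeR R := x ord0 i.

Let rV_set0 : g_sigma_preimage coord set0.
Proof. exact: sigma_algebra0. Qed.

Let rV_setC A : g_sigma_preimage coord A -> g_sigma_preimage coord (~` A).
Proof. exact: sigma_algebraC. Qed.

Let rV_bigcup (F : _^nat) : (forall i, g_sigma_preimage coord (F i)) ->
  g_sigma_preimage coord (\bigcup_i (F i)).
Proof. exact: sigma_algebra_bigcup. Qed.

(* The product sigma-algebra of R^n, which is its Borel sigma-algebra. *)
HB.instance Definition _ := @isMeasurable.Build rV_display
  'rV[R]_n (g_sigma_preimage coord) rV_set0 rV_setC rV_bigcup.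

Lemma measurable_coord (i : 'I_n) : measurable_fun [set: 'rV[R]_n] (coord i).
Proof.
move=> _ Y mY; rewrite setTI; apply: sub_sigma_algebra => /=.
rewrite -bigcup_seq/=; exists i => /=; first by rewrite mem_index_enum.
by exists Y => //; rewrite setTI.
Qed.

Lemma measurable_fun_coordP d (T : measurableType d) (f : T -> 'rV[R]_n) :
  (forall i, measurable_fun [set: T] (fun x => coord i (f x))) ->
  measurable_fun [set: T] f.
Proof.
move=> mf.
have H : g_sigma_preimage (fun i => coord i \o f) `<=` @measurable _ T.
  apply: smallest_sub; first exact: sigma_algebra_measurable.
  rewrite -bigcup_seq; apply: bigcup_sub => i _ A [B mB <-]; exact: mf.
rewrite g_sigma_preimage_comp in H.
by move=> _ A mA; apply: H; exists A.
Qed.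

End rV_measurable.

Section lebesgue_rV.
Context (R : realType).

Definition cons_rV n (z : measurableTypeR R * 'rV[R]_n) : 'rV[R]_n.+1 :=
  @row_mx R 1 1 n (const_mx z.1) z.2.

Definition uncons_rV n (x : 'rV[R]_n.+1) : measurableTypeR R * 'rV[R]_n :=
  (x ord0 ord0, \row_(i < n) x ord0 (lift ord0 i)).

Lemma cons_rVK n : cancel (@cons_rV n) (@uncons_rV n).
Proof.
move=> [a x]; rewrite /cons_rV /uncons_rV /=; congr (_, _).
  transitivity (@row_mx R 1 1 n (const_mx a) x ord0 (lshift n ord0)).
    by congr (row_mx _ _ _ _); exact: val_inj.
  by rewrite row_mxEl mxE.
apply/rowP => i; rewrite mxE.
transitivity (@row_mx R 1 1 n (const_mx a) x ord0 (rshift 1 i)).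
  by congr (row_mx _ _ _ _); exact: val_inj.
by rewrite row_mxEr.
Qed.

Lemma measurable_cons_rV n : measurable_fun setT (@cons_rV n).
Proof.
apply: measurable_fun_coordP => i.
case: (unliftP ord0 i) => [j|] ->.
- apply: (eq_measurable_fun
    (fun z : measurableTypeR R * 'rV[R]_n => z.2 ord0 j)).
    by move=> z _; have /(congr1 snd)/rowP/(_ j) := cons_rVK z; rewrite mxE.
  exact: (measurableT_comp (measurable_coord j) measurable_snd).
- apply: (eq_measurable_fun
    (fun z : measurableTypeR R * 'rV[R]_n => z.1)).
    by move=> z _; have /(congr1 fst) := cons_rVK z.
  exact: measurable_fst.
Qed.

Lemma measurable_uncons_rV n : measurable_fun setT (@uncons_rV n).
Proof.
apply/measurable_fun_pairP; split => /=.
  exact: (@measurable_coord R n.+1 ord0).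
apply: measurable_fun_coordP => i.
apply: (eq_measurable_fun (fun x : 'rV[R]_n.+1 => x ord0 (lift ord0 i))).
  by move=> x _; rewrite /= mxE.
exact: (@measurable_coord R n.+1 (lift ord0 i)).
Qed.

Section step.
Context (n : nat) (m : {sigma_finite_measure set 'rV[R]_n -> \bar R}).

Definition lebesgue_step : set 'rV[R]_n.+1 -> \bar R :=
  pushforward (@lebesgue_measure R \x m)%E (@cons_rV n).

HB.instance Definition _ := Measure.copy lebesgue_step
  (measure_function_pushforward__canonical__measure_function_Measure
    (@lebesgue_measure R \x m)%E (@measurable_cons_rV n)).

Let sigma_finite_step : sigma_finite setT lebesgue_step.
Proof.
have /sigma_finiteP[F [TF ndF Foo]] := sigma_finiteT (@lebesgue_measure R).
have /sigma_finiteP[G [TG ndG Goo]] := sigma_finiteT m.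
exists (fun i => @uncons_rV n @^-1` (F i `*` G i)).
  rewrite -preimage_bigcup; apply/esym/seteqP; split => // x _ /=.
  have [i _ Fi] : (\bigcup_i F i) (uncons_rV x).1 by rewrite -TF.
  have [j _ Gj] : (\bigcup_i G i) (uncons_rV x).2 by rewrite -TG.
  exists (maxn i j) => //; split => /=.
  - by move: Fi; apply/subsetPset/ndF/leq_maxl.
  - by move: Gj; apply/subsetPset/ndG/leq_maxr.
move=> i; have [mF finF] := Foo i; have [mG finG] := Goo i.
have mFG : measurable (F i `*` G i) by exact: measurableX.
split.
  by rewrite -[X in measurable X]setTI; exact: measurable_uncons_rV.
rewrite /lebesgue_step /pushforward -comp_preimage.
rewrite (_ : _ \o _ = id); last by apply/funext => z; exact: cons_rVK.
by rewrite preimage_id product_measure1E// lte_mul_pinfty// ge0_fin_numE.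
Qed.

HB.instance Definition _ :=
  Measure_isSigmaFinite.Build _ _ _ lebesgue_step sigma_finite_step.

End step.

Fixpoint lebesgue_rV n : {sigma_finite_measure set 'rV[R]_n -> \bar R} :=
  match n with
  | 0 => \d_(0 : 'rV[R]_0)
  | m.+1 => lebesgue_step (lebesgue_rV m)
  end.

End lebesgue_rV.

Section smooth.
Context (R : realType) (n : nat).
Implicit Types f g : 'rV[R]_n -> R.

Definition dirvec (i : 'I_n) : 'rV[R]_n := delta_mx ord0 i.

(* [partials [:: i1; i2; ..] f] differentiates [f] along [i1], then [i2], etc. *)
Fixpoint partials (l : seq 'I_n) f : 'rV[R]_n -> R :=
  if l is i :: l' then partials l' (fun x => 'D_(dirvec i) f x) else f.

Definition smooth f := forall l,
  continuous (partials l f) /\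
  forall i x, derivable (partials l f) x (dirvec i).

Let Ck k f := forall l, (size l <= k)%N ->
  continuous (partials l f) /\
  forall i x, derivable (partials l f) x (dirvec i).

Let Ck_derive k i f : Ck k.+1 f -> Ck k (fun x => 'D_(dirvec i) f x).
Proof. by move=> sf l lk; exact: (sf (i :: l)). Qed.

Let partials_lin_Ck k l (a : R) f g : (size l <= k)%N -> Ck k f -> Ck k g ->
  partials l (a *: f + g) = a *: partials l f + partials l g.
Proof.
elim: k l f g => [|k IH] [//|i l] f g //= lk sf sg.
rewrite -IH//; [|exact: Ck_derive|exact: Ck_derive].
congr partials; apply/funext => x.
have df := (sf [::] isT).2 i x; have dg := (sg [::] isT).2 i x.
by rewrite deriveD//; [rewrite deriveZ|exact: derivableZ].
Qed.

Let Ck_lin k (a : R) f g : Ck k f -> Ck k g -> Ck k (a *: f + g).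
Proof.
move=> sf sg l lk; rewrite (@partials_lin_Ck k)//.
have [cf df] := sf l lk; have [cg dg] := sg l lk; split.
  move=> x; apply: (@continuousD _ _ _ (a *: partials l f)); last exact: cg.
  apply: (@continuousM _ _ (cst a) (partials l f)); last exact: cf.
  exact: cst_continuous.
by move=> i x; apply: derivableD; [apply: derivableZ; exact: df|exact: dg].
Qed.

Let Ck_mul k f g : smooth f -> smooth g -> Ck k (f * g).
Proof.
elim: k f g => [|k IH] f g sf sg [|i l] //= lk.
- split=> [x|i x].
    by apply: (@continuousM _ _ f g); [exact: (sf [::]).1|exact: (sg [::]).1].
  by apply: derivableM; [exact: (sf [::]).2|exact: (sg [::]).2].
- split=> [x|i x].
    by apply: (@continuousM _ _ f g); [exact: (sf [::]).1|exact: (sg [::]).1].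
  by apply: derivableM; [exact: (sf [::]).2|exact: (sg [::]).2].
- rewrite (_ : (fun x => _) = 1 *: ((fun x => 'D_(dirvec i) f x) * g)
      + f * (fun x => 'D_(dirvec i) g x)); last first.
    apply/funext => x; have df := (sf [::]).2 i x; have dg := (sg [::]).2 i x.
    by rewrite deriveM// addrC scale1r; congr (_ + _); exact: mulrC.
  apply: (@Ck_lin k) => //; apply: IH => // l'.
    exact: (sf (i :: l')).
  exact: (sg (i :: l')).
Qed.

Lemma smooth0 : smooth 0.
Proof.
have E l : partials l 0 = 0.
  elim: l => [//|i l IH] /=; rewrite -[RHS]IH; congr partials.
  by apply/funext => x; rewrite derive_cst.
move=> l; rewrite E; split; first exact: cst_continuous.
by move=> i x; exact: derivable_cst.
Qed.

Lemma smooth_lin (a : R) f g : smooth f -> smooth g -> smooth (a *: f + g).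
Proof. by move=> sf sg l; apply: (@Ck_lin (size l)) => // l' _. Qed.

Lemma smoothM f g : smooth f -> smooth g -> smooth (f * g).
Proof. by move=> sf sg l; exact: (@Ck_mul (size l)). Qed.

Lemma smooth_derive i f : smooth f -> smooth (fun x => 'D_(dirvec i) f x).
Proof. by move=> sf l; exact: (sf (i :: l)). Qed.

Definition support f : set 'rV[R]_n := closure [set x | f x != 0].

Lemma support_derive i f :
  support (fun x => 'D_(dirvec i) f x) `<=` support f.
Proof.
have /closure_id cl := @closed_closure _ [set x | f x != 0].
rewrite /support cl.
apply: closureS => x /= dfx; apply: contrapT => nfx; move/negP: dfx; apply.
have f0 : \near x, f x = cst 0 x.
  have : open (~` support f) by exact/closed_openC/closed_closure.
  rewrite openE => /(_ x nfx); apply: filterS => y nfy /=.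
  by apply: contrapT => /eqP fy; apply: nfy; exact: subset_closure.
by rewrite (near_eq_derive _ f0) derive_cst.
Qed.

(* C_c^oo(Omega), each element being extended by 0 to R^n *)
Definition is_testfun (Omega : set 'rV[R]_n) f :=
  [/\ smooth f, compact (support f) & support f `<=` Omega].

Lemma is_testfun_sub Omega f g : is_testfun Omega f -> smooth g ->
  support g `<=` support f -> is_testfun Omega g.
Proof.
move=> [_ cf fO] sg gf; split => //; last exact: subset_trans fO.
by apply: (subclosed_compact _ cf gf); exact: closed_closure.
Qed.

Lemma is_testfun_derive Omega i f :
  is_testfun Omega f -> is_testfun Omega (fun x => 'D_(dirvec i) f x).
Proof.
move=> tf; apply: (is_testfun_sub tf); last exact: support_derive.
by case: tf => sf _ _; exact: smooth_derive.
Qed.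

Lemma is_testfunM Omega f g :
  is_testfun Omega f -> is_testfun Omega g -> is_testfun Omega (f * g).
Proof.
move=> tf [sg _ _]; apply: (is_testfun_sub tf).
  by case: tf => sf _ _; exact: smoothM.
by apply: closureS => x /=; apply: contra => /eqP fx; rewrite -[(f * g) x]/(f x * g x) fx mul0r.
Qed.

Variable Omega : set 'rV[R]_n.

Definition testfun_pred : {pred ('rV[R]_n -> R)} :=
  mem [set f | is_testfun Omega f].

Lemma testfun_submod_closed : submod_closed testfun_pred.
Proof.
split=> [|a f g]; rewrite !inE.
  split; first exact: smooth0.
  - rewrite /support (_ : [set x | _] = set0) ?closure0; first exact: compact0.
    by apply/seteqP; split => // x /=; rewrite eqxx.
  - rewrite /support (_ : [set x | _] = set0) ?closure0//.
    by apply/seteqP; split => // x /=; rewrite eqxx.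
move=> [sf cf fO] [sg cg gO].
have S : support (a *: f + g) `<=` support f `|` support g.
  rewrite /support -closureU; apply: closureS => x /=.
  have [fx|fx _] := eqVneq (f x) 0; last by left.
  by rewrite -[(_ + _) x]/(a * f x + g x) fx mulr0 add0r; right.
split; first exact: smooth_lin.
  by apply: (subclosed_compact _ _ S); [exact: closed_closure|exact: compactU].
by apply: subset_trans S _ => x [/fO|/gO].
Qed.

HB.instance Definition _ :=
  GRing.isSubmodClosed.Build R ('rV[R]_n -> R) testfun_pred testfun_submod_closed.

Record testfun := Testfun {
  testfun_val :> 'rV[R]_n -> R ;
  testfunP : testfun_val \in testfun_pred }.

HB.instance Definition _ := [isSub for testfun_val].
HB.instance Definition _ := gen_eqMixin testfun.
HB.instance Definition _ := gen_choiceMixin testfun.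
HB.instance Definition _ := [SubChoice_isSubLmodule of testfun by <:].

Lemma testfunW (f : testfun) : is_testfun Omega f.
Proof. exact: set_mem (testfunP f). Qed.

Definition testfun_mul (f g : testfun) : testfun :=
  Testfun (mem_set (is_testfunM (testfunW f) (testfunW g))).

Definition testfun_derive (i : 'I_n) (f : testfun) : testfun :=
  Testfun (mem_set (is_testfun_derive i (testfunW f))).

End smooth.

Arguments testfun {R n} Omega.

Section distributions.
Context (R : realType) (n : nat) (Omega : set 'rV[R]_n).
Implicit Types (T : testfun Omega -> R) (phi psi : testfun Omega).

(* Linear, and on each compact K bounded by finitely many of the seminorms
   sup |d^l phi|: the real M below ranges over the common upper bounds of the
   derivatives of phi of order at most N. *)
Definition is_distribution T :=
  (forall (a : R) phi psi, T (a *: phi + psi) = a * T phi + T psi) /\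
  forall K : set 'rV[R]_n, compact K -> K `<=` Omega ->
    exists (C : R) (N : nat), forall phi (M : R), support phi `<=` K ->
      (forall l x, (size l <= N)%N -> `|partials l phi x| <= M) ->
      `|T phi| <= C * M.

Definition regular (f : 'rV[R]_n -> R) : testfun Omega -> R :=
  fun phi => \int[lebesgue_rV R n]_(x in Omega) (f x * phi x).

Definition dist_mul phi T : testfun Omega -> R :=
  fun psi => T (testfun_mul phi psi).

Definition multiindex k := {ffun 'I_n -> 'I_k.+1}.

Definition mlength k (nu : multiindex k) : nat := (\sum_i nu i)%N.

Definition testfun_mderive k (nu : multiindex k) phi : testfun Omega :=
  foldr (fun i => iter (nu i) (testfun_derive i)) phi (enum 'I_n).

Definition dist_mderive k (nu : multiindex k) T : testfun Omega -> R :=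
  fun phi => (-1) ^+ mlength nu * T (testfun_mderive nu phi).

End distributions.

Record snspace (R : realType) (n : nat) (Omega : set 'rV[R]_n) := SNSpace {
  sn_carrier : set (testfun Omega -> R) ;
  sn_index : Type ;
  sn_seminorm : sn_index -> (testfun Omega -> R) -> \bar R }.

Definition sn_sort (R : realType) (n : nat) (Omega : set 'rV[R]_n)
  (X : snspace Omega) : Type := sn_carrier X.
Coercion sn_sort : snspace >-> Sortclass.

Section snspace_topology.
Context (R : realType) (n : nat) (Omega : set 'rV[R]_n).
Implicit Types X Y : snspace Omega.

Definition sn_ball X (i : sn_index X) (u : X) (e : R) : set X :=
  [set v : X | (sn_seminorm i (val v - val u)%R < e%:E)%E].

Definition sn_subbase X : set (set X) :=
  [set B | exists i u e, 0 < e /\ B = sn_ball i u e].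

HB.instance Definition _ X := Choice.on (sn_sort X).
HB.instance Definition _ X :=
  isSubBaseTopological.Build (sn_sort X) (sn_subbase (X := X)) id.

Definition sn_incl X Y (XY : sn_carrier X `<=` sn_carrier Y) : X -> Y :=
  fun u => exist _ (val u) (mem_set (XY _ (set_mem (valP u)))).

Definition sn_embeds X Y :=
  exists XY : sn_carrier X `<=` sn_carrier Y, continuous (sn_incl XY).

End snspace_topology.

Section sobolev.
Context (R : realType) (n : nat) (Omega : set 'rV[R]_n).
Implicit Types (T : testfun Omega -> R) (f : 'rV[R]_n -> R) (s p theta : R).

Local Notation lambda := (lebesgue_rV R n).

Definition euclid_norm (x : 'rV[R]_n) : R := Num.sqrt (\sum_i x ord0 i ^+ 2).

Definition Lp p : set ('rV[R]_n -> R) := [set f | f \_ Omega \in Lfun lambda p%:E].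

Definition Lp_norm p f : \bar R := 'N[lambda]_p%:E [EFin \o f \_ Omega].

Definition gagliardo theta p f : \bar R :=
  ((\int[(lambda \x lambda)%E]_(z in Omega `*` Omega)
     (`|f z.1 - f z.2| `^ p /
        euclid_norm (z.1 - z.2) `^ (n%:R + theta * p))%:E) `^ p^-1)%E.

(* The L^p functions inducing the distribution T. *)
Definition Lp_repr p T : set ('rV[R]_n -> R) :=
  [set f | [/\ Lp p f,
    forall phi : testfun Omega, lambda.-integrable Omega (EFin \o (f \* phi)) &
    T = regular f]].

(* Two elements of [Lp_repr p T] agree almost everywhere on Omega, so that the
   infima below are taken over at most one value; they are +oo when T is not
   in L^p. *)
Definition dist_Lp_norm p T : \bar R := ereal_inf (Lp_norm p @` Lp_repr p T).

Definition dist_gagliardo theta p T : \bar R :=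
  ereal_inf (gagliardo theta p @` Lp_repr p T).

(* The norm of W^{s,p}(Omega) for 0 <= s, with s = k + theta; it is +oo
   outside of W^{s,p}(Omega). *)
Definition sobolev_norm_ge0 s p T : \bar R :=
  let k := Num.truncn s in
  let theta := s - k%:R in
  (\sum_(nu : multiindex n k | (mlength nu <= k)%N)
      dist_Lp_norm p (dist_mderive nu T)
   + if theta == 0%R then 0
     else \sum_(nu : multiindex n k | mlength nu == k)
       dist_gagliardo theta p (dist_mderive nu T))%E.

Definition sobolev_ge0 s p : snspace Omega := {|
  sn_carrier := [set T | is_distribution T /\ (sobolev_norm_ge0 s p T < +oo)%E] ;
  sn_index := unit ;
  sn_seminorm := fun=> sobolev_norm_ge0 s p |}.

(* W_0^{s,p}(Omega) for 0 <= s *)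
Definition sobolev0 s p : set (testfun Omega -> R) :=
  val @` closure [set u : sobolev_ge0 s p |
    exists phi : testfun Omega, val u = regular phi].

Definition sobolev0_opnorm s p (L : (testfun Omega -> R) -> R) : \bar R :=
  ereal_sup [set `|L u|%:E | u in
    [set u | sobolev0 s p u /\ (sobolev_norm_ge0 s p u <= 1)%E]].

(* Bounded linear functionals on W_0^{s,p}(Omega); their values elsewhere are
   irrelevant. *)
Definition sobolev0_dual s p : set ((testfun Omega -> R) -> R) :=
  [set L | (forall (a : R) u v, sobolev0 s p u -> sobolev0 s p v ->
      L (a *: u + v) = a * L u + L v) /\
    (sobolev0_opnorm s p L < +oo)%E].

(* The dual norm of the functional on W_0^{s,p}(Omega) restricting to T, which
   is unique by density of the test functions; +oo if there is none. *)
Definition dual_norm s p T : \bar R :=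
  ereal_inf [set sobolev0_opnorm s p L | L in
    [set L | sobolev0_dual s p L /\
      forall phi : testfun Omega, L (regular phi) = T phi]].

Definition sobolev_norm s p T : \bar R :=
  if 0 <= s then sobolev_norm_ge0 s p T else dual_norm (- s) (1 - p^-1)^-1 T.

Definition sobolev s p : snspace Omega := {|
  sn_carrier := [set T | is_distribution T /\ (sobolev_norm s p T < +oo)%E] ;
  sn_index := unit ;
  sn_seminorm := fun=> sobolev_norm s p |}.

Definition sobolev_loc s p : snspace Omega := {|
  sn_carrier := [set T | is_distribution T /\
    forall phi, sn_carrier (sobolev s p) (dist_mul phi T)] ;
  sn_index := testfun Omega ;
  sn_seminorm := fun phi T => sobolev_norm s p (dist_mul phi T) |}.

End sobolev.

Arguments sobolev {R n} Omega s p.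
Arguments sobolev_loc {R n} Omega s p.

(* Main.v *)
Require Import Defs.
From mathcomp Require Import all_boot all_order all_algebra finmap.
From mathcomp Require Import all_classical all_reals all_analysis.
From mathcomp Require Import measurable_realfun.

(** The inclusion of sets is immediate: if phi T lies in W^{s1,p1} for every
    test function phi, it lies in W^{s2,p2}.  For the continuity, multiplication
    by a fixed phi is a map [loc_mul] from W^{s,p}_loc to W^{s,p}, and a
    subbasic ball of W^{s2,p2}_loc, defined by the seminorm of index phi, is the
    preimage of a ball of W^{s2,p2} under [loc_mul] followed by the given
    embedding.  So everything rests on the continuity of [loc_mul]
    ([loc_mul_continuous]).

    That continuity would be a tautology if the balls of W^{s,p} were centred at
    products phi u, but a subbasic ball has an arbitrary centre w.  The triangle
    inequality of the W^{s,p} norm provides, around each point phi u of such a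
    ball, a smaller ball centred at phi u; together with the fact that the zero
    distribution has norm 0, this makes the preimage of the ball a
    neighbourhood of u.

    The triangle inequality ([sobolev_normD]) has two cases.  For 0 <= s it is
    Minkowski's inequality: the Gagliardo seminorm of f is itself an L^p norm
    over Omega x Omega, that of the weighted difference quotient of f
    ([gagliardoE]), so one inequality covers both kinds of terms.  The
    measurability of Omega, needed to restrict functions to Omega x Omega,
    comes from its openness ([open_measurable_rV]).  For s < 0 it is the
    subadditivity of the operator norm of functionals. *)

Import Order.TTheory GRing.Theory Num.Theory.
Import numFieldNormedType.Exports.

Local Open Scope classical_set_scope.
Local Open Scope ring_scope.

(** * Open subsets of R^n are measurable *)

(** The sigma-algebra of R^n is generated by the coordinates, whereas its
    topology comes from the sup norm: an open set is the union of the countably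
    many rational cubes that it contains. *)
Lemma open_measurable_rV (R : realType) (n : nat) (O : set 'rV[R]_n) :
  open O -> measurable O.
Proof.
move=> oO.
pose box (c : 'rV[rat]_n * rat) : set 'rV[R]_n :=
  [set x | forall i, `|ratr (c.1 ord0 i) - x ord0 i| < ratr c.2].
have mbox c : measurable (box c).
  have -> : box c = \bigcap_(i in [set: 'I_n])
      ((fun x : 'rV[R]_n => x ord0 i) @^-1`
        [set y | `|ratr (c.1 ord0 i) - y| < ratr c.2]).
    by apply/seteqP; split=> x h i; [move=> _; exact: h|exact: (h i I)].
  apply: fin_bigcap_measurable; first exact: finite_finset.
  move=> i _; rewrite -[X in measurable X]setTI.
  apply: measurable_coord => //.
  rewrite (_ : [set y | _] = ball (ratr (c.1 ord0 i) : R) (ratr c.2)) //.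
  rewrite ball_itv; exact: measurable_itv.
suff -> : O = \bigcup_(c in [set c | box c `<=` O]) box c.
  rewrite bigcup_mkcond; apply: countable_bigcupT_measurable => // c.
  by case: ifP => _; [exact: mbox|exact: measurable0].
apply/seteqP; split => [x Ox|x [c /= cO]]; last exact: cO.
  have /nbhs_ballP[r r0 rO] : nbhs x O by exact: open_nbhs_nbhs.
  (* Two points of a cube of half-side e are at distance less than 2 e, so a
     cube with e < r / 2 that contains x stays in the ball of radius r. *)
  have [e /andP[]] : exists e : rat, (0 < ratr e :> R) && (ratr e < r / 2).
    have /rat_in_itvoo[e] : 0 < r / 2 by rewrite divr_gt0.
    by rewrite in_itv/=; exists e.
  move=> e0 er.
  have /choice[q qx] : forall i, exists q : rat, `|ratr q - x ord0 i| < ratr e.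
    move=> i.
    have /rat_in_itvoo[q] : x ord0 i - ratr e < x ord0 i + ratr e.
      by rewrite ltrBlDr -addrA ltrDl addr_gt0.
    by rewrite in_itv/= => qi; exists q; rewrite ltr_distl.
  exists (\row_i q i, e) => [y /= yb|i] /=; last by rewrite mxE.
  apply: rO; split=> // i j; rewrite ord1 /ball/=.
  rewrite (le_lt_trans (ler_distD (ratr (q j)) _ _))//.
  rewrite (splitr r) ltrD// (lt_trans _ er)//.
    by rewrite distrC.
  by have := yb j; rewrite mxE.
Qed.

(** * Minkowski's inequality for the L^p and Gagliardo terms *)

(** Subadditivity passes to infima, also when one of them is +oo because it is
    taken over the empty set. *)
Lemma ereal_inf_leD (R : realType) (A B C : set (\bar R)) :
  (forall x, A x -> 0 <= x)%E -> (forall x, B x -> 0 <= x)%E ->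
  (forall x y, A x -> B y -> exists2 z, C z & z <= x + y)%E ->
  (ereal_inf C <= ereal_inf A + ereal_inf B)%E.
Proof.
move=> A0 B0 AB.
have iA : (0 <= ereal_inf A)%E by exact: le_ereal_inf_tmp.
have iB : (0 <= ereal_inf B)%E by exact: le_ereal_inf_tmp.
have [->|By] := eqVneq (ereal_inf B) +oo%E; first
  by rewrite addey ?leey// -ltNye (lt_le_trans _ iA).
rewrite addeC -leeBlDl; last by rewrite ge0_fin_numE// lt_neqAle By leey.
apply: le_ereal_inf_tmp => x Ax.
rewrite leeBlDl; last by rewrite ge0_fin_numE// lt_neqAle By leey.
have [->|xy] := eqVneq x +oo%E; first
  by rewrite addey ?leey// -ltNye (lt_le_trans _ iB).
have xf : x \is a fin_num by rewrite ge0_fin_numE ?A0// lt_neqAle xy leey.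
rewrite addeC -leeBlDl//.
apply: le_ereal_inf_tmp => y By'; rewrite leeBlDl//.
have [z Cz] := AB _ _ Ax By'; apply: le_trans; exact: ereal_inf_lbound.
Qed.

Section norms.
Context {R : realType} {n : nat} {Omega : set 'rV[R]_n}.
Implicit Types (T S : testfun Omega -> R) (f g : 'rV[R]_n -> R) (s p theta : R).

Local Notation lambda := (lebesgue_rV R n).

Lemma restrict_add f g : (f + g) \_ Omega = f \_ Omega + g \_ Omega.
Proof.
apply/funext => x; rewrite -[RHS]/((f \_ Omega) x + (g \_ Omega) x) /patch.
by case: ifP => // _; rewrite addr0.
Qed.

Lemma Lp_repr0 p : 1 <= p -> measurable Omega -> Lp_repr (Omega := Omega) p 0 0.
Proof.
move=> p1 mO.
have r0 : (0 : 'rV[R]_n -> R) \_ Omega = 0.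
  by apply/funext => x; rewrite /patch; case: ifP.
split.
- by rewrite /Lp /= r0; exact: rpred0.
- move=> phi; rewrite (_ : _ \o _ = cst 0%E); first exact: integrable0.
  by apply/funext => x /=; rewrite mul0r.
- apply/funext => phi; rewrite -[LHS]/(0 : R) /regular.
  rewrite /Rintegral integral0_eq//.
  by move=> x _; rewrite mul0r.
Qed.

Lemma Lp_reprD p T S f g : 1 <= p -> measurable Omega ->
  Lp_repr p T f -> Lp_repr p S g -> Lp_repr p (T + S) (f + g).
Proof.
move=> p1 mO [Lf fi ->] [Lg gi ->]; split.
- by rewrite /Lp/= restrict_add; exact: rpredD.
- move=> phi; rewrite (_ : _ \o _ =
      ((EFin \o (f \* phi)%R) \+ (EFin \o (g \* phi)%R))%E).
    exact: integrableD.
  by apply/funext => x /=; rewrite -EFinD -mulrDl.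
- apply/funext => phi; rewrite -[LHS]/(regular f phi + regular g phi) /regular.
  rewrite -RintegralD//; [|exact: fi|exact: gi].
  by apply: eq_Rintegral => x _; rewrite -mulrDl.
Qed.

Lemma Lp_measurable p f : Lp Omega p f -> measurable_fun setT (f \_ Omega).
Proof. by move=> Lf; have /sub_Lfun_mfun/set_mem := Lf. Qed.

Lemma Lp_normD p f g : 1 <= p -> Lp Omega p f -> Lp Omega p g ->
  (Lp_norm Omega p (f + g)%R <= Lp_norm Omega p f + Lp_norm Omega p g)%E.
Proof.
move=> p1 Lf Lg; rewrite /Lp_norm restrict_add.
apply: minkowski_EFin => //; [exact: Lp_measurable Lf|exact: Lp_measurable Lg].
Qed.

Lemma Lp_norm0 p : 1 <= p -> Lp_norm Omega p 0 = 0%E.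
Proof.
move=> p1; rewrite /Lp_norm.
rewrite (_ : _ \o _ = cst 0%E) ?Lnorm0//.
  by rewrite eqe gt_eqF// (lt_le_trans _ p1).
by apply/funext => x /=; rewrite /patch; case: ifP.
Qed.

(** The weight carries the p-th root of the Gagliardo kernel.  It is a negative
    power and not the inverse of a positive one, so that its p-th power is
    computed by [powRrM] also on the diagonal. *)
Definition diff_quotient theta p f (z : 'rV[R]_n * 'rV[R]_n) : R :=
  (f z.1 - f z.2) * euclid_norm (z.1 - z.2) `^ (- ((n%:R + theta * p) / p)).

(** This turns the subadditivity of the Gagliardo seminorm into Minkowski's
    inequality on R^n x R^n. *)
Lemma gagliardoE theta p f : p != 0 ->
  gagliardo Omega theta p f =
  Lnorm (lambda \x lambda)%E p%:E
    (EFin \o (diff_quotient theta p f) \_ (Omega `*` Omega)).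
Proof.
move=> p0; rewrite unlock /gagliardo; congr (_ `^ _)%E.
rewrite [LHS]integral_mkcond.
apply: eq_integral => z _ /=.
rewrite /patch; case: ifP => _; last by rewrite normr0 powR0.
congr EFin; rewrite /diff_quotient normrM powRM//.
rewrite [X in _ = _ * X `^ _]ger0_norm ?powR_ge0// -powRrM mulNr divfK//.
by rewrite powRN.
Qed.

Lemma measurable_diff_quotient theta p f : measurable Omega ->
  Lp Omega p f ->
  measurable_fun setT ((diff_quotient theta p f) \_ (Omega `*` Omega)).
Proof.
move=> mO /Lp_measurable mf.
have mOO : measurable (Omega `*` Omega) by exact: measurableX.
apply: (measurable_restrictT (diff_quotient theta p f) mOO).1.
(* Only the restriction of f to Omega is known to be measurable. *)
apply: (eq_measurable_fun (diff_quotient theta p (f \_ Omega))).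
  by move=> z; rewrite inE => -[z1 z2]; rewrite /diff_quotient /patch !mem_set.
apply: measurable_funTS; apply: measurable_funM.
  apply: measurable_funB; apply: (measurableT_comp mf).
    exact: measurable_fst.
  exact: measurable_snd.
apply: (measurableT_comp (measurable_powR _)).
apply: (eq_measurable_fun (fun z : 'rV[R]_n * 'rV[R]_n =>
    (\sum_i ((z.1 - z.2) ord0 i) ^+ 2) `^ 2^-1)).
  by move=> z _; rewrite powR12_sqrt// sumr_ge0// => i _; exact: sqr_ge0.
apply: (measurableT_comp (measurable_powR _)).
apply: measurable_sum => i; apply: measurable_funX.
apply: (eq_measurable_fun (fun z : 'rV[R]_n * 'rV[R]_n =>
    z.1 ord0 i - z.2 ord0 i)).
  by move=> z _; rewrite !mxE.
apply: measurable_funB; apply: (measurableT_comp (measurable_coord i)).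
  exact: measurable_fst.
exact: measurable_snd.
Qed.

Lemma gagliardoD theta p f g : 1 <= p -> measurable Omega ->
  Lp Omega p f -> Lp Omega p g ->
  (gagliardo Omega theta p (f + g)%R <=
   gagliardo Omega theta p f + gagliardo Omega theta p g)%E.
Proof.
move=> p1 mO Lf Lg.
have p0 : p != 0 by rewrite gt_eqF// (lt_le_trans _ p1).
rewrite !gagliardoE//.
rewrite (_ : _ \_ _ = (diff_quotient theta p f) \_ (Omega `*` Omega) \+
   (diff_quotient theta p g) \_ (Omega `*` Omega)).
  by apply: minkowski_EFin => //; exact: measurable_diff_quotient.
apply/funext => z; rewrite /patch/=; case: ifP => _; last by rewrite addr0.
by rewrite /diff_quotient -mulrDl opprD addrACA.
Qed.

Lemma gagliardo0 theta p : p != 0 -> gagliardo Omega theta p 0 = 0%E.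
Proof.
move=> p0; rewrite gagliardoE// (_ : _ \o _ = cst 0%E) ?Lnorm0//.
apply/funext => z /=; rewrite /patch; case: ifP => // _.
by rewrite /diff_quotient subr0 mul0r.
Qed.

(** * The norm of W^{s,p}: triangle inequality and value at zero *)

(** Sums of representatives of T and of S represent T + S.  The functional N
    stands for both the L^p norm and the Gagliardo seminorm. *)
Lemma Lp_repr_infD p (N : ('rV[R]_n -> R) -> \bar R) T S :
  1 <= p -> measurable Omega -> (forall f, 0 <= N f)%E ->
  (forall f g, Lp Omega p f -> Lp Omega p g ->
    (N (f + g)%R <= N f + N g)%E) ->
  (ereal_inf (N @` Lp_repr p (T + S)%R) <=
   ereal_inf (N @` Lp_repr p T) + ereal_inf (N @` Lp_repr p S))%E.
Proof.
move=> p1 mO N0 ND; apply: ereal_inf_leD.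
- by move=> _ [f _ <-].
- by move=> _ [f _ <-].
- move=> _ _ [f rf <-] [g rg <-]; exists (N (f + g)).
    by exists (f + g) => //; exact: Lp_reprD.
  by apply: ND; [case: rf|case: rg].
Qed.

Lemma Lp_repr_inf0 p (N : ('rV[R]_n -> R) -> \bar R) :
  1 <= p -> measurable Omega -> N 0 = 0%E ->
  (ereal_inf (N @` Lp_repr p (0%R : testfun Omega -> R)) <= 0)%E.
Proof.
move=> p1 mO N0; rewrite -N0; apply: ereal_inf_lbound.
by exists 0 => //; exact: Lp_repr0.
Qed.

Lemma dist_mderiveD k (nu : multiindex n k) T S :
  dist_mderive nu (T + S) = dist_mderive nu T + dist_mderive nu S.
Proof. by apply/funext => phi; rewrite /dist_mderive mulrDr. Qed.

Lemma dist_mderive0 k (nu : multiindex n k) :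
  dist_mderive nu (0%R : testfun Omega -> R) = 0.
Proof. by apply/funext => phi; rewrite /dist_mderive mulr0. Qed.

Lemma sobolev_norm_ge0D s p T S : 1 <= p -> measurable Omega ->
  (sobolev_norm_ge0 s p (T + S)%R <=
   sobolev_norm_ge0 s p T + sobolev_norm_ge0 s p S)%E.
Proof.
move=> p1 mO; rewrite /sobolev_norm_ge0 addeACA; apply: leeD.
  rewrite -big_split/=; apply: lee_sum => nu _; rewrite dist_mderiveD.
  apply: Lp_repr_infD => //; first by move=> f; exact: Lnorm_ge0.
  by move=> f g; exact: Lp_normD.
case: ifP => _; first by rewrite adde0.
rewrite -big_split/=; apply: lee_sum => nu _; rewrite dist_mderiveD.
apply: Lp_repr_infD => //; first by move=> f; exact: poweR_ge0.
by move=> f g; exact: gagliardoD.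
Qed.

Lemma sobolev_norm_ge0_0 s p : 1 <= p -> measurable Omega ->
  (sobolev_norm_ge0 s p (0%R : testfun Omega -> R) <= 0)%E.
Proof.
move=> p1 mO; rewrite /sobolev_norm_ge0 -[leRHS]adde0; apply: leeD.
  rewrite sume_le0// => nu _; rewrite dist_mderive0.
  by apply: Lp_repr_inf0 => //; exact: Lp_norm0.
case: ifP => // _; rewrite sume_le0// => nu _; rewrite dist_mderive0.
apply: Lp_repr_inf0 => //; apply: gagliardo0.
by rewrite gt_eqF// (lt_le_trans _ p1).
Qed.

Lemma sobolev0_opnormD s p L M :
  (sobolev0_opnorm s p (L \+ M)%R <=
   sobolev0_opnorm (Omega:=Omega) s p L + sobolev0_opnorm s p M)%E.
Proof.
apply: ge_ereal_sup => _ [u su <-].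
rewrite (@le_trans _ _ (`|L u|%:E + `|M u|%:E)%E)//.
  by rewrite -EFinD lee_fin ler_normD.
by apply: leeD; apply: ereal_sup_ubound; exists u.
Qed.

(** The strict form with real bounds avoids the sum of -oo and +oo: a dual norm
    is +oo when no functional restricts to the distribution, and nothing in its
    form as an infimum excludes the value -oo. *)
Lemma dual_normD s p T S (a b : R) :
  (dual_norm s p T < a%:E)%E -> (dual_norm s p S < b%:E)%E ->
  (dual_norm s p (T + S)%R < (a + b)%:E)%E.
Proof.
move=> /ereal_inf_lt[_ [L [[Llin Lfin] LT] <-] La].
move=> /ereal_inf_lt[_ [M [[Mlin Mfin] MS] <-] Mb].
have LMab : (sobolev0_opnorm s p (L \+ M)%R < (a + b)%:E)%E.
  by rewrite (le_lt_trans (sobolev0_opnormD _ _ _ _))// EFinD lteD.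
apply: le_lt_trans LMab; apply: ereal_inf_lbound; exists (L \+ M) => //.
split; last by move=> phi; rewrite /= LT MS.
split; last first.
  by rewrite (le_lt_trans (sobolev0_opnormD _ _ _ _))// lte_add_pinfty.
by move=> c u v su sv /=; rewrite Llin// Mlin// mulrDr addrACA.
Qed.

Lemma dual_norm0 s p : (dual_norm s p (0%R : testfun Omega -> R) <= 0)%E.
Proof.
have op0 : (sobolev0_opnorm (Omega:=Omega) s p (cst 0%R) <= 0)%E.
  by apply: ge_ereal_sup => _ [u su <-]; rewrite normr0.
apply: (le_trans _ op0); apply: ereal_inf_lbound; exists (cst 0) => //.
split=> //; split; first by move=> c u v _ _; rewrite mulr0 addr0.
by rewrite (le_lt_trans op0) ?ltry.
Qed.

Lemma sobolev_normD s p T S (a b : R) : 1 <= p -> measurable Omega ->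
  (sobolev_norm s p T < a%:E)%E -> (sobolev_norm s p S < b%:E)%E ->
  (sobolev_norm s p (T + S)%R < (a + b)%:E)%E.
Proof.
move=> p1 mO; rewrite /sobolev_norm; case: ifP => _; last exact: dual_normD.
move=> Ta Sb; rewrite (le_lt_trans (sobolev_norm_ge0D s p T S p1 mO))//.
by rewrite EFinD lteD.
Qed.

Lemma sobolev_norm0 s p : 1 <= p -> measurable Omega ->
  (sobolev_norm s p (0%R : testfun Omega -> R) <= 0)%E.
Proof.
move=> p1 mO; rewrite /sobolev_norm; case: ifP => _; last exact: dual_norm0.
exact: sobolev_norm_ge0_0.
Qed.

End norms.

(** * Continuity of multiplication by a test function *)

Section topology.
Context {R : realType} {n : nat} {Omega : set 'rV[R]_n}.
Implicit Types (s p : R) (phi : testfun Omega).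

Lemma sn_subbase_nbhs (X : snspace Omega) (u : X) (B : set X) :
  sn_subbase B -> B u -> nbhs u B.
Proof.
move=> sB Bu; apply: open_nbhs_nbhs; split=> //.
exists [set B]; last by rewrite bigcup_set1.
move=> _ ->; exists [fset B]%fset; first by move=> C /fset1P ->; exact/mem_set.
by rewrite set_fset1 bigcap_set1.
Qed.

Lemma sn_subbase_continuous (T : topologicalType) (X : snspace Omega)
    (f : T -> X) :
  (forall t B, sn_subbase B -> B (f t) -> nbhs t (f @^-1` B)) -> continuous f.
Proof.
move=> H t A; rewrite nbhsE => -[U [[D sD eU] Uu] UA].
move: Uu; rewrite -eU => -[B DB Bu].
have [F sF eB] := sD _ DB.
suff : nbhs t (f @^-1` B).
  by apply: filterS => x Bx; apply: UA; rewrite -eU; exists B.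
rewrite -eB.
apply: (@filterS _ _ _ (\bigcap_(C in [set` F]) (f @^-1` C))) => //.
apply: filter_bigI => C CF; apply: H; first exact/set_mem/sF.
by move: Bu; rewrite -eB; apply.
Qed.

Lemma sobolev_loc_mul s p phi (T : testfun Omega -> R) :
  sn_carrier (sobolev_loc Omega s p) T ->
  sn_carrier (sobolev Omega s p) (dist_mul phi T).
Proof. by case=> _; exact. Qed.

Definition loc_mul s p phi (u : sobolev_loc Omega s p) :
    sobolev Omega s p :=
  exist _ (dist_mul phi (val u))
    (mem_set (sobolev_loc_mul s p phi _ (set_mem (valP u)))).

(** Given a ball of radius e and centre w that contains phi u, choose a < e
    bounding the norm of phi u - w: the seminorm ball of radius e - a around u
    is then mapped into it. *)
Lemma loc_mul_continuous s p phi : 1 <= p ->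
  measurable Omega -> continuous (@loc_mul s p phi).
Proof.
move=> p1 mO; apply: sn_subbase_continuous => u _ [i [w [e [e0 ->]]]].
rewrite /sn_ball/= => ue.
have [a Na ae] : exists2 a : R,
    (sobolev_norm s p (dist_mul phi (val u) - val w)%R < a%:E)%E & a < e.
  move: ue; case: (sobolev_norm _ _ _) => [r|//|].
  - rewrite lte_fin => re; exists ((r + e) / 2); last by rewrite midf_lt.
    by rewrite lte_fin midf_lt.
  - by move=> _; exists (e - 1); rewrite ?ltNyr ?gtrBl.
apply: (@filterS _ _ _ (@sn_ball _ _ _ (sobolev_loc Omega s p) phi u (e - a))).
  move=> v; rewrite /sn_ball/= => vu.
  have := sobolev_normD _ _ _ _ _ _ p1 mO vu Na; rewrite subrK.
  congr (sobolev_norm _ _ _ < _)%E; apply/funext => psi.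
  by rewrite -[LHS]/(val v _ - val u _ + (val u _ - val w _)) addrA subrK.
apply: sn_subbase_nbhs; first by exists phi, u, (e - a); rewrite subr_gt0.
rewrite /sn_ball/= subrr.
by rewrite (le_lt_trans (sobolev_norm0 _ _ p1 mO))// lte_fin subr_gt0.
Qed.

End topology.

Theorem theorem5p19 (R : realType) (n : nat) (n_gt0 : (0 < n)%N)
    (Omega : set 'rV[R]_n) (Omega_neq0 : Omega !=set0) (Omega_open : open Omega)
    (s1 s2 p1 p2 : R) (p1_gt1 : 1 < p1) (p2_gt1 : 1 < p2) :
  sn_embeds (sobolev Omega s1 p1) (sobolev Omega s2 p2) ->
  sn_embeds (sobolev_loc Omega s1 p1) (sobolev_loc Omega s2 p2).
Proof.
move=> [sub cts].
have sub_loc : sn_carrier (sobolev_loc Omega s1 p1) `<=`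
    sn_carrier (sobolev_loc Omega s2 p2).
  by move=> T [dT Tloc]; split=> // phi; have /sub := Tloc phi.
exists sub_loc; apply: sn_subbase_continuous => u _ [phi [w [e [e0 ->]]]] ue.
have mO := open_measurable_rV _ _ _ Omega_open.
(* The ball of index phi is the preimage of a norm ball under this composite. *)
have c : continuous (sn_incl sub \o loc_mul _ _ phi).
  move=> v; apply: continuous_comp; last exact: cts.
  exact: (loc_mul_continuous _ _ _ (ltW p1_gt1)).
apply: (c u (@sn_ball _ _ _ (sobolev Omega s2 p2) tt (loc_mul _ _ phi w) e)).
apply: sn_subbase_nbhs => //.
by exists tt, (loc_mul _ _ phi w), e.
Qed.
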